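(* Let $P$ be any one of the properties OH, WOH, LOH, ASQ, LASQ. Let $X$ be a real Banach space such that for every $\delta>0$ there is some Banach space $Y$ with property $P$ which is isomorphic to $X$ and satisfies $d(X,Y)<1+\delta$. Then $X$ also has property $P$.
   Context: All Banach spaces are real. $B_X$ is the closed unit ball and $S_X$ the unit sphere of $X$; $X^*$ is the dual space. For isomorphic Banach spaces $X,Y$, the Banach-Mazur distance is $d(X,Y):=\inf\{\|T\|\,\|T^{-1}\|: T:X\to Y \text{ is an isomorphism}\}$ (isomorphism = bounded linear bijection with bounded inverse). $X$ is octahedral (OH) if for every finite-dimensional subspace $E$ of $X$ and every $\varepsilon>0$ there is some $y\in S_X$ such that $\|x+y\|\geq(1-\varepsilon)(\|x\|+1)$ for all $x\in E$. $X$ is weakly octahedral (WOH) if for every finite-dimensional subspace $E$ of $X$, every $x^*\in B_{X^*}$ and every $\varepsilon>0$ there is some $y\in S_X$ such that $\|x+y\|\geq(1-\varepsilon)(|x^*(x)|+1)$ for all $x\in E$. $X$ is locally octahedral (LOH) if for every $x\in X$ and every $\varepsilon>0$ there exists $y\in S_X$ such that $\|sx+y\|\geq(1-\varepsilon)(|s|\,\|x\|+1)$ for all $s\in\mathbb{R}$. $X$ is almost square (ASQ) if for all $n\in\mathbb{N}$ and all $x_1,\dots,x_n\in S_X$ there is a sequence $(y_k)_{k\in\mathbb{N}}$ in $B_X$ such that $\|y_k\|\to 1$ and $\|x_i+y_k\|\to 1$ for all $i=1,\dots,n$. $X$ is locally almost square (LASQ) if for every $x\in S_X$ there is a sequence $(y_k)_{k\in\mathbb{N}}$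 in $B_X$ such that $\|y_k\|\to 1$ and $\|x\pm y_k\|\to 1$ (for both signs). *)

(* Defs.v *)
From HB Require Import structures.
From mathcomp Require Import all_boot all_order all_algebra.
From mathcomp Require Import all_classical all_reals all_analysis.

Set Implicit Arguments.
Unset Strict Implicit.
Unset Printing Implicit Defensive.

Import Order.TTheory GRing.Theory Num.Theory.
Import numFieldNormedType.Exports.

Local Open Scope classical_set_scope.
Local Open Scope ring_scope.

Definition unit_ball (R : realType) (X : normedModType R) : set X :=
  [set x | `|x| <= 1].
Arguments unit_ball {R} X.

Definition unit_sphere (R : realType) (X : normedModType R) : set X :=
  [set x | `|x| = 1].
Arguments unit_sphere {R} X.

(* [sup] takes the junk value 0 on unbounded sets, so this is the operator
   norm only for maps that are bounded on the unit ball; it is always used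
   together with [bounded_fun_norm]. *)
Definition opnorm (R : realType) (X Y : normedModType R) (f : X -> Y) : R :=
  sup [set `|f x| | x in unit_ball X].

Definition dual_unit_ball (R : realType) (X : normedModType R) :
    set {linear X -> R^o} :=
  [set f : {linear X -> R^o} | bounded_fun_norm f /\ opnorm f <= 1].
Arguments dual_unit_ball {R} X.

Definition fin_dim_subspace (R : realType) (X : normedModType R) (E : set X) :=
  submod_closed [in E] /\
  exists (n : nat) (e : 'I_n -> X), (forall i, E (e i)) /\
    forall x, E x -> exists c : 'I_n -> R, x = \sum_(i < n) c i *: e i.

(* Linearity of the inverse [S] is automatic, hence not required. *)
Definition isomorphism_with_inverse (R : realType) (X Y : normedModType R)
    (T : {linear X -> Y}) (S : Y -> X) :=
  [/\ cancel T S, cancel S T, bounded_fun_norm T & bounded_fun_norm S].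

Definition isomorphic (R : realType) (X Y : normedModType R) :=
  exists (T : {linear X -> Y}) (S : Y -> X), isomorphism_with_inverse T S.

(* Meaningful only when X and Y are isomorphic, since [inf set0 = 0]. *)
Definition banach_mazur (R : realType) (X Y : normedModType R) : R :=
  inf [set r | exists (T : {linear X -> Y}) (S : Y -> X),
    isomorphism_with_inverse T S /\ r = opnorm T * opnorm S].

Definition octahedral (R : realType) (X : normedModType R) :=
  forall E : set X, fin_dim_subspace E -> forall eps : R, 0 < eps ->
  exists2 y, unit_sphere X y &
    forall x, E x -> (1 - eps) * (`|x| + 1) <= `|x + y|.

Definition weakly_octahedral (R : realType) (X : normedModType R) :=
  forall E : set X, fin_dim_subspace E ->
  forall f : {linear X -> R^o}, dual_unit_ball X f ->
  forall eps : R, 0 < eps ->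
  exists2 y, unit_sphere X y &
    forall x, E x -> (1 - eps) * (`|f x| + 1) <= `|x + y|.

Definition locally_octahedral (R : realType) (X : normedModType R) :=
  forall (x : X) (eps : R), 0 < eps ->
  exists2 y, unit_sphere X y &
    forall s : R, (1 - eps) * (`|s| * `|x| + 1) <= `|s *: x + y|.

(* The number of vectors is at least 1; this only matters for X = {0}. *)
Definition almost_square (R : realType) (X : normedModType R) :=
  forall (n : nat) (x : 'I_n -> X), (0 < n)%N ->
  (forall i, unit_sphere X (x i)) ->
  exists y : nat -> X,
    [/\ forall k, unit_ball X (y k),
        `|y k| @[k --> \oo] --> (1 : R) &
        forall i, `|x i + y k| @[k --> \oo] --> (1 : R)].

Definition locally_almost_square (R : realType) (X : normedModType R) :=
  forall x : X, unit_sphere X x ->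
  exists y : nat -> X,
    [/\ forall k, unit_ball X (y k),
        `|y k| @[k --> \oo] --> (1 : R),
        `|x + y k| @[k --> \oo] --> (1 : R) &
        `|x - y k| @[k --> \oo] --> (1 : R)].

Inductive geometric_property := OH | WOH | LOH | ASQ | LASQ.

Definition has_property (R : realType) (P : geometric_property)
    (X : normedModType R) : Prop :=
  match P with
  | OH => octahedral X
  | WOH => weakly_octahedral X
  | LOH => locally_octahedral X
  | ASQ => almost_square X
  | LASQ => locally_almost_square X
  end.

(* Main.v *)
Require Import Defs.
From HB Require Import structures.
From mathcomp Require Import all_boot all_order all_algebra.
From mathcomp Require Import all_classical all_reals all_analysis.
From mathcomp Require Import lra.
Import Order.TTheory GRing.Theory Num.Theory.
Import numFieldNormedType.Exports.
Local Open Scope ring_scope.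

(** All five properties only ask for vectors that satisfy norm inequalities up
    to an arbitrarily small error, so they survive a map that distorts norms
    arbitrarily little.

    If [banach_mazur X Y < 1 + delta], some isomorphism [T] has
    [opnorm T * opnorm T^-1 < 1 + delta]; multiplying [T] by [opnorm T^-1]
    gives [|x| <= |T x| <= (1 + delta) * |x|]
    ([almost_isometry_of_banach_mazur]).  With this one-sided normalisation the
    inverse [S] is a contraction, so that [S] maps the unit ball of [Y] into
    that of [X], and [f \o S] is in the dual ball of [Y] when [f] is in that
    of [X].

    The three octahedral properties provide [y] in the unit sphere of [Y] with
    [|T x + y|] at least [(1 - delta) * (p x + 1)] for all [x] in some set,
    where [p x] is [|x|] or [|f x|]; here [|x|] may replace [|T x|] because
    [|x| <= |T x|].
    The normalised vector [S y / |S y|] is within [delta] of [S y], and it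
    satisfies the same bounds in [X] with [1 - 3 * delta] for [1 - delta]
    ([octahedral_transfer]).

    The two square properties both say that certain finite families of unit
    vectors ([x_1, ..., x_n] arbitrary, respectively [x, -x]) admit a sequence
    almost square along them.  The vectors [T x_i] need not have norm one, but are
    within [delta] of [T x_i / |T x_i|]; if [y] is almost square along these,
    [S y] is almost square along the [x_i], again with error [3 * delta]
    ([almost_square_along_transfer]). *)

Lemma norm_le_opnorm (R : realType) (X Y : normedModType R)
    (f : {linear X -> Y}) (x : X) :
  bounded_fun_norm f -> `|f x| <= opnorm f * `|x|.
Proof.
move=> bf; have [->|x0] := eqVneq x 0; first by rewrite linear0 !normr0 mulr0.
have nx : 0 < `|x| by rewrite normr_gt0.
rewrite -ler_pdivrMr// mulrC.
have -> : `|x|^-1 * `|f x| = `|f (`|x|^-1 *: x)|.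
  by rewrite linearZ normrZ ger0_norm// invr_ge0.
apply: ub_le_sup.
  have [M fM] := bf 1; exists M => _ [z z1 <-]; exact: fM.
by exists (`|x|^-1 *: x) => //; rewrite /unit_ball/= normfZV.
Qed.

(** The lower bound carries no constant: any isomorphism can be rescaled so that
    its inverse is a contraction, and this keeps unit balls and dual unit balls
    stable when vectors and functionals are moved through [S]. *)
Definition almost_isometry {R : realType} {X Y : normedModType R} (delta : R)
    (T : {linear X -> Y}) (S : {linear Y -> X}) :=
  [/\ cancel T S, cancel S T, forall x, `|x| <= `|T x| &
      forall x, `|T x| <= (1 + delta) * `|x| ].

Lemma almost_isometry_of_banach_mazur (R : realType) (X Y : normedModType R)
    (delta : R) :
  isomorphic X Y -> banach_mazur X Y < 1 + delta ->
  exists (T : {linear X -> Y}) (S : {linear Y -> X}), almost_isometry delta T S.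
Proof.
move=> [T0 [S0 iso0]] /inf_lt [].
  by exists (opnorm T0 * opnorm S0), T0, S0.
move=> _ [T [S [[TS ST bT bS] ->]]] ltd.
have [S' SE] : exists S' : {linear Y -> X}, S' = S :> (Y -> X).
  by exists (HB.pack S
    (GRing.isLinear.Build R Y X *:%R S (can2_linear TS ST)) : {linear Y -> X}).
subst S; rename S' into S.
have leT x : `|T x| <= opnorm T * `|x| by exact: norm_le_opnorm.
have leS y : `|S y| <= opnorm S * `|y| by exact: norm_le_opnorm.
(* A zero norm of the inverse, for which no rescaling is possible, only occurs
   when [X] is trivial. *)
have [b0|b0] := leP (opnorm S) 0.
  have X0 (x : X) : x = 0.
    apply/eqP; rewrite -normr_le0 -(TS x); apply: le_trans (leS _) _.
    by rewrite mulr_le0_ge0.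
  exists T, S; split=> // x; rewrite (X0 x) linear0 !normr0 ?mulr0//.
exists (opnorm S \*: T), ((opnorm S)^-1 \*: S); split=> x /=.
- by rewrite linearZ scalerA mulVf ?gt_eqF// scale1r /= TS.
- by rewrite linearZ scalerA mulfV ?gt_eqF// scale1r /= ST.
- by rewrite normrZ gtr0_norm// -{1}(TS x); exact: leS.
- rewrite normrZ gtr0_norm//.
  apply: le_trans (ler_wpM2l (ltW b0) (leT x)) _.
  by rewrite mulrA ler_wpM2r// mulrC ltW.
Qed.

(** The error used below: transferring a vector costs [3 * delta], and
    [delta <= 1] keeps the factor [1 - delta] nonnegative. *)
Lemma small_error_exists (R : realType) (eps : R) : 0 < eps ->
  exists delta : R, [/\ 0 < delta, delta <= 1 & 3 * delta <= eps].
Proof.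
move=> e0; have [m1 me] : Num.min 1 eps <= 1 /\ Num.min 1 eps <= eps.
  by rewrite !ge_min !lexx orbT.
have m0 : 0 < Num.min 1 eps by rewrite lt_min ltr01.
by exists (Num.min 1 eps / 3); split; lra.
Qed.

(** The vector is [u = S y / |S y|].  One [delta] is already in the hypothesis
    on [T x + y], one is lost when the norm is pulled back by [T], and one in
    replacing [S y] by [u], as [1 - delta <= |S y| <= 1]; the last loss is
    absorbed thanks to [1 <= p + 1].  The vector [u] serves all [x] and [p] at
    once, so the lemma applies to every octahedral property. *)
Lemma octahedral_transfer (R : realType) (X Y : normedModType R)
    (delta eps : R) (T : {linear X -> Y}) (S : {linear Y -> X}) (y : Y) :
  almost_isometry delta T S -> 0 <= delta <= 1 -> 3 * delta <= eps ->
  unit_sphere Y y ->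
  exists2 u, unit_sphere X u & forall (x : X) (p : R), 0 <= p ->
    (1 - delta) * (p + 1) <= `|T x + y| -> (1 - eps) * (p + 1) <= `|x + u|.
Proof.
move=> [TS ST leT geT] /andP[d0 d1] de y1; rewrite /unit_sphere/= in y1.
set z := S y.
have z_le1 : `|z| <= 1 by rewrite -y1 -(ST y) leT.
have z_ge : 1 - delta <= `|z|.
  by have := geT z; rewrite ST y1; nra.
have z0 : z != 0.
  apply/eqP => z0; have := geT z; rewrite ST y1 z0 normr0 mulr0.
  by rewrite ler10.
have nz : 0 < `|z| by rewrite normr_gt0.
exists (`|z|^-1 *: z); first by rewrite /unit_sphere/= normfZV.
move=> x p p0 hp.
have uz : `| `|z|^-1 *: z - z| <= delta.
  rewrite -{3}[z]scale1r -scalerBl normrZ -{2}(ger0_norm (ltW nz)) -normrM.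
  rewrite mulrBl mulVf ?gt_eqF// mul1r ger0_norm ?subr_ge0//; lra.
have := geT (x + z); rewrite linearD ST => hxz.
have : `|x + z| - `| `|z|^-1 *: z - z| <= `|x + `|z|^-1 *: z|.
  have -> : x + `|z|^-1 *: z = (x + z) - - (`|z|^-1 *: z - z).
    by rewrite opprK addrACA subrr addr0.
  by rewrite -[X in _ - X]normrN lerB_dist.
have : (1 - 2 * delta) * (p + 1) <= `|x + z| by nra.
nra.
Qed.

Lemma fin_dim_subspace_image (R : realType) (X Y : normedModType R)
    (T : {linear X -> Y}) (E : set X) :
  fin_dim_subspace E -> fin_dim_subspace (T @` E)%classic.
Proof.
move=> [[E0 Elin] [n [e [Ee Espan]]]]; split; first split.
- by apply/mem_set; exists 0; [exact/set_mem|rewrite linear0].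
- move=> a _ _ /set_mem[u Eu <-] /set_mem[v Ev <-]; apply/mem_set.
  exists (a *: u + v); last by rewrite linearP.
  by apply/set_mem/Elin; exact/mem_set.
exists n, (fun i => T (e i)); split=> [i|_ [x /Espan[c ->] <-]].
  by exists (e i).
by exists c; rewrite linear_sum; apply: eq_bigr => i _; rewrite linearZ.
Qed.

Lemma dual_unit_ballP (R : realType) (X : normedModType R)
    (f : {linear X -> R^o}) :
  dual_unit_ball X f <-> forall x, `|f x| <= `|x|.
Proof.
split=> [[bf f1] x|fle].
  apply: le_trans (norm_le_opnorm _ _ _ f x bf) _.
  by rewrite ler_piMl.
split; first by move=> r; exists r => x; exact/le_trans/fle.
apply: ge_sup => [|_ [x x1 <-]]; last exact: le_trans (fle x) x1.
by exists `|f 0|, 0 => //; rewrite /unit_ball/= normr0.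
Qed.

(** Almost squareness is this property for all finite nonempty families of unit
    vectors, local almost squareness is this property for all families [x, -x]
    with [x] a unit vector; isolating it lets one transfer argument serve
    both. *)
Definition almost_square_along {R : realType} {X : normedModType R} {I : Type}
    (x : I -> X) :=
  exists y : nat -> X,
    [/\ forall k, unit_ball X (y k),
        (`|y k| @[k --> \oo] --> (1 : R))%classic &
        forall i, (`|x i + y k| @[k --> \oo] --> (1 : R))%classic].

(** Approximate vectors are what a change of space produces: a sequence in [X]
    has to be assembled from vectors that come from different spaces [Y].
    Finiteness of [I] makes the convergence uniform in the index. *)
Lemma almost_square_alongP (R : realType) (X : normedModType R) (I : finType)
    (x : I -> X) :
  almost_square_along x <-> forall eps : R, 0 < eps ->
    exists y : X, [/\ `|y| <= 1, 1 - eps <= `|y| &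
      forall i, `|1 - `|x i + y| | <= eps].
Proof.
split=> [[y [y1 cy cxy]] eps e0|H].
  have near_xy :
      (\forall k \near \oo, forall i, `|1 - `|x i + y k| | < eps)%classic.
    by apply: filter_forall => i; by move/cvgrPdist_lt: (cxy i); exact.
  have near_y : (\forall k \near \oo, `|1 - `|y k| | < eps)%classic.
    by move/cvgrPdist_lt: cy; exact.
  have [k [ky kxy]] := filter_ex (filterI near_y near_xy).
  exists (y k); split; first exact: y1.
    by have := ler_norm (1 - `|y k|); lra.
  by move=> i; exact/ltW/kxy.
have [y Hy] := choice (fun k : nat => H k.+1%:R^-1 ltac:(by rewrite invr_gt0)).
exists y; split=> [k||i]; first by have [] := Hy k.
- apply/cvgrPdist_lt => e e0.
  near=> k; apply: le_lt_trans (_ : k.+1%:R^-1 < e).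
    have [yk1 ykge _] := Hy k.
    by rewrite ger0_norm ?subr_ge0// lerBlDr -lerBlDl.
  by near: k; exact: (near_infty_natSinv_lt (PosNum e0)).
- apply/cvgrPdist_lt => e e0.
  near=> k; apply: le_lt_trans (_ : k.+1%:R^-1 < e).
    by have [_ _] := Hy k; exact.
  by near: k; exact: (near_infty_natSinv_lt (PosNum e0)).
Unshelve. all: by end_near. Qed.

(** [S y] works for the [x i] when [y] works for the normalised [T (x i)]: the
    vectors [T (x i)] have norm between [1] and [1 + delta], so normalising
    moves them by at most [delta], and [S] distorts the norm of
    [T (x i) + y] by at most a factor [1 + delta]. *)
Lemma almost_square_along_transfer (R : realType) (X : normedModType R)
    (I : finType) (x : I -> X) :
  (forall i, unit_sphere X (x i)) ->
  (forall delta : R, 0 < delta ->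
    exists (Y : normedModType R) (T : {linear X -> Y}) (S : {linear Y -> X}),
      almost_isometry delta T S /\
      almost_square_along (fun i => `|T (x i)|^-1 *: T (x i))) ->
  almost_square_along x.
Proof.
move=> x1 H; apply/almost_square_alongP => eps e0.
have [delta [d0 d1 de]] := small_error_exists _ _ e0.
have [Y [T [S [[TS ST leT geT] /almost_square_alongP]]]] := H _ d0.
move=> /(_ _ d0)[y [y1 yge yx]].
exists (S y); split.
- by apply: le_trans y1; rewrite -{2}(ST y).
- by have := geT (S y); rewrite ST; have := normr_ge0 (S y); nra.
move=> i; have := yx i; set w := _ *: _ => wy.
have := leT (x i); have := geT (x i); rewrite (x1 i) mulr1 => Tle Tge.
have nT : 0 < `|T (x i)| by lra.
have Tw : `|T (x i) - w| <= delta.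
  rewrite /w -{1}[T (x i)]scale1r -scalerBl normrZ -{2}(ger0_norm (ltW nT)).
  rewrite -normrM mulrBl mulVf ?gt_eqF// mul1r ger0_norm ?subr_ge0//; lra.
have up : `|T (x i) + y| <= `|w + y| + `|T (x i) - w|.
  suff -> : T (x i) + y = (w + y) + (T (x i) - w) by exact: ler_normD.
  by rewrite [RHS]addrC addrA subrK.
have lo : `|w + y| <= `|T (x i) + y| + `|T (x i) - w|.
  rewrite (distrC (T (x i)) w).
  suff -> : w + y = (T (x i) + y) + (w - T (x i)) by exact: ler_normD.
  by rewrite [RHS]addrC addrA subrK.
have := leT (x i + S y); have := geT (x i + S y); rewrite linearD ST.
move: wy; rewrite !ler_norml => /andP[wy1 wy2] gexy lexy.
by apply/andP; split; nra.
Qed.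

(** The two signs become the index set [bool], through [|-x + y| = |x - y|]. *)
Lemma locally_almost_squareP (R : realType) (X : normedModType R) :
  locally_almost_square X <-> forall x : X, unit_sphere X x ->
    almost_square_along (fun b : bool => (-1) ^+ b *: x).
Proof.
split=> H x /H[y].
  move=> [y1 cy cp cm]; exists y; split=> // -[].
    under eq_fun do rewrite expr1 scaleN1r addrC -normrN opprB.
    exact: cm.
  by under eq_fun do rewrite scale1r.
move=> [y1 cy cxy]; exists y; split=> //.
  by have := cxy false; under eq_fun do rewrite scale1r.
by have := cxy true; under eq_fun do rewrite expr1 scaleN1r addrC -normrN opprB.
Qed.

Theorem proposition2p14 (R : realType) (P : geometric_property)
    (X : completeNormedModType R)
    (hX : forall delta : R, 0 < delta ->
      exists Y : completeNormedModType R,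
        [/\ has_property P Y, isomorphic X Y & banach_mazur X Y < 1 + delta]) :
  has_property P X.
Proof.
have near_iso (delta : R) : 0 < delta ->
    exists (Y : normedModType R) (T : {linear X -> Y}) (S : {linear Y -> X}),
      has_property P Y /\ almost_isometry delta T S.
  move=> /hX[Y [PY iso bm]].
  have [T [S TS]] := almost_isometry_of_banach_mazur _ _ _ _ iso bm.
  by exists Y, T, S.
have oct_iso (eps : R) : 0 < eps -> exists (Y : normedModType R)
    (T : {linear X -> Y}) (S : {linear Y -> X}) (delta : R),
    [/\ has_property P Y, almost_isometry delta T S, 0 < delta,
        delta <= 1 & 3 * delta <= eps].
  move=> /small_error_exists[delta [d0 d1 de]].
  have [Y [T [S [PY TS]]]] := near_iso _ d0.
  by exists Y, T, S, delta.
case: P {hX} near_iso oct_iso => /= near_iso oct_iso.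
- move=> E fE eps /oct_iso[Y [T [S [delta [PY TS d0 d1 de]]]]].
  have [y y1 hy] := PY _ (fin_dim_subspace_image _ _ _ T _ fE) _ d0.
  have [|u u1 hu] := octahedral_transfer _ _ _ _ _ _ _ _ TS _ de y1.
    by rewrite ltW.
  exists u => // x Ex; apply: hu => //.
  apply: le_trans (hy (T x) _); last by exists x.
  have [_ _ leT _] := TS.
  by rewrite ler_wpM2l ?subr_ge0// lerD2r leT.
- move=> E fE f /dual_unit_ballP f1 eps.
  move=> /oct_iso[Y [T [S [delta [PY TS d0 d1 de]]]]].
  have [TK SK leT _] := TS.
  pose g : {linear Y -> R^o} := f \o S.
  have g1 : dual_unit_ball Y g.
    apply/dual_unit_ballP => y /=; apply: le_trans (f1 _) _.
    by rewrite -{2}(SK y).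
  have [y y1 hy] := PY _ (fin_dim_subspace_image _ _ _ T _ fE) _ g1 _ d0.
  have [|u u1 hu] := octahedral_transfer _ _ _ _ _ _ _ _ TS _ de y1.
    by rewrite ltW.
  exists u => // x Ex; apply: hu => //.
  have := hy (T x); rewrite /= TK; apply; by exists x.
- move=> x eps /oct_iso[Y [T [S [delta [PY TS d0 d1 de]]]]].
  have [y y1 hy] := PY (T x) _ d0.
  have [|u u1 hu] := octahedral_transfer _ _ _ _ _ _ _ _ TS _ de y1.
    by rewrite ltW.
  exists u => // s; apply: hu; first by rewrite mulr_ge0.
  rewrite linearZ; apply: le_trans (hy s).
  have [_ _ leT _] := TS.
  by rewrite ler_wpM2l ?subr_ge0// lerD2r ler_wpM2l.
- move=> n x n0 x1; apply: almost_square_along_transfer => // delta.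
  move=> /near_iso[Y [T [S [PY TS]]]]; exists Y, T, S; split=> //.
  apply: PY => // i; rewrite /unit_sphere/= normfZV//.
  have [_ _ leT _] := TS.
  by rewrite -normr_gt0; apply: lt_le_trans (leT _); rewrite (x1 i).
- apply/locally_almost_squareP => x x1.
  apply: almost_square_along_transfer => [b|delta].
    by rewrite /unit_sphere/= normrZ normrX normrN1 expr1n mul1r.
  move=> /near_iso[Y [T [S [/locally_almost_squareP PY TS]]]].
  exists Y, T, S; split=> //.
  have [_ _ leT _] := TS.
  have -> : (fun b : bool => `|T ((-1) ^+ b *: x)|^-1 *: T ((-1) ^+ b *: x)) =
      (fun b : bool => (-1) ^+ b *: (`|T x|^-1 *: T x)).
    apply/funext => b.
    by rewrite linearZ normrZ normrX normrN1 expr1n mul1r !scalerA mulrC.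
  apply: PY; rewrite /unit_sphere/= normfZV//.
  by rewrite -normr_gt0; apply: lt_le_trans (leT _); rewrite x1.
Qed.
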